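(* Let $n\ge 2$, let $G\subset\mathbb R^n$ be a neighbourhood of the origin, and let $f:G\to\mathbb R^n$ be a $C^1$-smooth vector field with $f(0)=0$. Suppose there exists a sequence $\{H_i\}_{i\in\mathbb N}$ of nested (connected closed) hypersurfaces contained in $G$, each bounding the origin, which converges to the origin, such that for every $i$ and every $x\in H_i$ $$S_i(x)=\langle \vec N_i(x), f(x)\rangle\ \ge\ 0,$$ where $\vec N_i$ is the unit normal vector field on $H_i$ directed towards the internal component of $\mathbb R^n\setminus H_i$. Then the origin is a Lyapunov stable equilibrium of the system $dx/dt=f(x)$.
   Context: Notation: $\rho$ is the Euclidean metric and $\operatorname{diam}$ the corresponding diameter. For a point $p$, $x_p(t)$ denotes the solution of $dx/dt=f(x)$ with $x_p(0)=p$. Lyapunov stability: an equilibrium $x_0$ is Lyapunov stable if for every $\epsilon>0$ there is $\delta>0$ such that $\|p-x_0\|<\delta$ implies that $\|x_p(t)-x_0\|<\epsilon$ for every $t\ge 0$. Hypersurfaces: a connected closed hypersurface in $\mathbb R^n$ is a connected smooth compact $(n-1)$-dimensional submanifold $H\subset\mathbb R^n$ with empty boundary. Its complement has exactly two components, one bounded and one unbounded; the bounded one is called the internal component. $H$ bounds a point $p$ if $p\notin H$ and every path from $p$ to any point $x\in\mathbb R^n$ with $\rho(p,x)>\operatorname{diam}(H)$ intersects $H$. A sequence $\{H_i\}$ of connected closed hypersurfaces is nested if $H_{i+1}$ is contained in the internal component of $\mathbb R^n\setminus H_i$ for every $i$. A nested sequence $\{H_i\}$ such that each $H_i$ bounds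 $p$ converges to $p$ if $d(p,H_i)=\max_{y\in H_i}\|p-y\|\to 0$ as $i\to\infty$. *)

(* Defs.v *)
From HB Require Import structures.
From mathcomp Require Import all_boot all_order all_algebra.
From mathcomp Require Import all_classical all_reals all_analysis.

Set Implicit Arguments.
Unset Strict Implicit.
Unset Printing Implicit Defensive.

Import Order.TTheory GRing.Theory Num.Theory.
Import numFieldNormedType.Exports.

Local Open Scope classical_set_scope.
Local Open Scope ring_scope.

(* The library's norm on 'rV[R]_n is the sup norm.  It induces the usual
   topology, derivatives and bounded sets, for which the library notions are
   used; all metric quantities use the Euclidean norm defined here. *)
Definition dot (R : realType) (n : nat) (u v : 'rV[R]_n) : R :=
  \sum_(i < n) u 0 i * v 0 i.

Definition enorm (R : realType) (n : nat) (u : 'rV[R]_n) : R :=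
  Num.sqrt (dot u u).

Definition edist (R : realType) (n : nat) (x y : 'rV[R]_n) : R :=
  enorm (x - y).

Definition diam (R : realType) (n : nat) (H : set 'rV[R]_n) : R :=
  sup [set edist x y | x in H & y in H].

(* C^k on U, through iterated partial derivatives; only used for U open. *)
Fixpoint Ck (R : realType) (n m : nat) (k : nat) (U : set 'rV[R]_n)
    (g : 'rV[R]_n -> 'rV[R]_m) : Prop :=
  match k with
  | 0%N => forall x, U x -> {for x, continuous g}
  | k'.+1 => (forall x, U x -> differentiable g x) /\
      forall j : 'I_n, Ck k' U (fun x => 'D_(delta_mx 0 j) g x)
  end.

Definition smooth (R : realType) (n m : nat) (U : set 'rV[R]_n)
    (g : 'rV[R]_n -> 'rV[R]_m) : Prop :=
  forall k : nat, Ck k U g.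

(* phi : U -> V is a C^oo diffeomorphism between open sets, with inverse psi;
   the values of phi outside U and of psi outside V are irrelevant. *)
Definition diffeomorphism (R : realType) (n : nat) (U V : set 'rV[R]_n)
    (phi psi : 'rV[R]_n -> 'rV[R]_n) : Prop :=
  [/\ open U, open V, smooth U phi, smooth V psi &
   (forall x, U x -> V (phi x) /\ psi (phi x) = x) /\
   (forall y, V y -> U (psi y) /\ phi (psi y) = y)].

(* k-dimensional smooth embedded submanifold without boundary: around each of
   its points some chart straightens H to the slice R^k x {0} of R^n. *)
Definition smooth_submanifold (R : realType) (n k : nat)
    (H : set 'rV[R]_n) : Prop :=
  forall p, H p -> exists U V phi psi,
    [/\ diffeomorphism U V phi psi, U p &
     forall x, U x -> (H x <-> forall j : 'I_n, (k <= j)%N -> phi x 0 j = 0)].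

Definition connected_closed_hypersurface (R : realType) (n : nat)
    (H : set 'rV[R]_n) : Prop :=
  [/\ H !=set0, connected H, compact H & smooth_submanifold n.-1 H].

(* The bounded component of the complement of H, as the set of the points
   whose connected component in the complement is bounded.  The condition
   ~ H x matters, as connected_component A x is empty when x is not in A. *)
Definition internal_component (R : realType) (n : nat)
    (H : set 'rV[R]_n) : set 'rV[R]_n :=
  [set x | ~ H x /\ bounded_set (connected_component (~` H) x)].

Definition bounds (R : realType) (n : nat) (H : set 'rV[R]_n)
    (p : 'rV[R]_n) : Prop :=
  ~ H p /\
  forall (x : 'rV[R]_n) (gamma : R -> 'rV[R]_n), diam H < edist p x ->
    {within `[0, 1], continuous gamma} -> gamma 0 = p -> gamma 1 = x ->
    exists2 t, t \in `[0, 1] & H (gamma t).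

Definition nested (R : realType) (n : nat) (H : nat -> set 'rV[R]_n) : Prop :=
  forall i, H i.+1 `<=` internal_component (H i).

Definition converges_to (R : realType) (n : nat) (H : nat -> set 'rV[R]_n)
    (p : 'rV[R]_n) : Prop :=
  (fun i => sup [set edist p y | y in H i]) @ \oo --> (0 : R).

Definition tangent_vector (R : realType) (n : nat) (H : set 'rV[R]_n)
    (x v : 'rV[R]_n) : Prop :=
  exists gamma : R -> 'rV[R]_n,
    [/\ gamma 0 = x, \forall t \near (0 : R), H (gamma t) &
     is_derive (0 : R) 1 gamma v].

(* Only the values of N on H matter.  These conditions determine N on H, so
   its continuity need not be required. *)
Definition inner_unit_normal (R : realType) (n : nat) (H : set 'rV[R]_n)
    (N : 'rV[R]_n -> 'rV[R]_n) : Prop :=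
  forall x, H x ->
    [/\ enorm (N x) = 1,
     forall v, tangent_vector H x v -> dot (N x) v = 0 &
     \forall t \near 0^'+, internal_component H (x + t *: N x)].

(* x is a solution on [0, +oo[ of dx/dt = f(x) in G with x(0) = p.  As values
   at negative times are unconstrained, the derivative at t = 0 being two-sided
   is no restriction: x can be continued by p + t f(p) for t < 0. *)
Definition solution (R : realType) (n : nat) (G : set 'rV[R]_n)
    (f : 'rV[R]_n -> 'rV[R]_n) (p : 'rV[R]_n) (x : R -> 'rV[R]_n) : Prop :=
  x 0 = p /\
  forall t, 0 <= t -> G (x t) /\ is_derive t 1 x (f (x t)).

(* Solutions from near x0 are required to exist for all t >= 0.  For a C^1
   field the solution is unique, and is quantified over universally. *)
Definition lyapunov_stable (R : realType) (n : nat) (G : set 'rV[R]_n)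
    (f : 'rV[R]_n -> 'rV[R]_n) (x0 : 'rV[R]_n) : Prop :=
  forall eps : R, 0 < eps -> exists2 delta : R, 0 < delta &
    forall p, enorm (p - x0) < delta ->
      (exists x, solution G f p x) /\
      (forall x, solution G f p x ->
         forall t, 0 <= t -> enorm (x t - x0) < eps).

Definition equilibrium (R : realType) (n : nat) (G : set 'rV[R]_n)
    (f : 'rV[R]_n -> 'rV[R]_n) (x0 : 'rV[R]_n) : Prop :=
  G x0 /\ f x0 = 0.

(* Main.v *)
Require Import Defs.
From mathcomp Require Import all_boot all_order all_algebra.
From mathcomp Require Import all_classical all_reals all_analysis.
From mathcomp Require Import ring lra.
Import Order.TTheory GRing.Theory Num.Theory.
Import numFieldNormedType.Exports.
Local Open Scope classical_set_scope.
Local Open Scope ring_scope.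

(** Fix i so large that H_i lies in a small cube inside G, and let K be the
    union of H_i and of the bounded components of its complement.  K is compact,
    lies in the same cube, and contains a neighbourhood of 0 because H_i bounds
    0; so it is enough that K is positively invariant.

    A ball that touches K from outside at a point z of H_i is orthogonal to
    every curve of H_i through z, so its radius w at z is a negative multiple of
    N_i(z) and <w, f(z)> <= 0.  This holds for the proximal normals of K at all
    of its points, and for Lipschitz f it makes K invariant (Nagumo, Bony,
    Brezis): the squared distance u of a solution to K satisfies u' <= 2 L u.

    Solutions are constructed for the bounded, globally Lipschitz field that
    agrees with f on the cube; as they stay in K, they solve x' = f(x). *)

(** * Euclidean and sup norms *)

Lemma ler_coord_norm {R : realType} {n : nat} (v : 'rV[R]_n) (i : 'I_n) :
  `|v 0 i| <= `|v|.
Proof.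
rewrite [leRHS]/Num.norm /= mx_normrE.
by apply/bigmax_geP; right => /=; exists (0, i).
Qed.

Lemma rV_norm_ler {R : realType} {n : nat} (v : 'rV[R]_n) (r : R) :
  0 <= r -> (forall i, `|v 0 i| <= r) -> `|v| <= r.
Proof.
move=> r0 vr; rewrite [leLHS]/Num.norm /= mx_normrE.
by apply/bigmax_leP; split=> // -[i j] _ /=; rewrite ord1.
Qed.

Lemma dotC {R : realType} {n : nat} (u v : 'rV[R]_n) : dot u v = dot v u.
Proof. by apply: eq_bigr => i _; rewrite mulrC. Qed.

Lemma dotDl {R : realType} {n : nat} (u v w : 'rV[R]_n) :
  dot (u + v) w = dot u w + dot v w.
Proof. by rewrite -big_split; apply: eq_bigr => i _; rewrite mxE mulrDl. Qed.

Lemma dotZl {R : realType} {n : nat} (a : R) (u v : 'rV[R]_n) :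
  dot (a *: u) v = a * dot u v.
Proof. by rewrite mulr_sumr; apply: eq_bigr => i _; rewrite mxE mulrA. Qed.

Lemma dotNl {R : realType} {n : nat} (u v : 'rV[R]_n) :
  dot (- u) v = - dot u v.
Proof. by rewrite -scaleN1r dotZl mulN1r. Qed.

Lemma dotBl {R : realType} {n : nat} (u v w : 'rV[R]_n) :
  dot (u - v) w = dot u w - dot v w.
Proof. by rewrite dotDl dotNl. Qed.

Lemma dotDr {R : realType} {n : nat} (u v w : 'rV[R]_n) :
  dot w (u + v) = dot w u + dot w v.
Proof. by rewrite !(dotC w) dotDl. Qed.

Lemma dotZr {R : realType} {n : nat} (a : R) (u v : 'rV[R]_n) :
  dot u (a *: v) = a * dot u v.
Proof. by rewrite !(dotC u) dotZl. Qed.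

Lemma dotBr {R : realType} {n : nat} (u v w : 'rV[R]_n) :
  dot w (u - v) = dot w u - dot w v.
Proof. by rewrite !(dotC w) dotBl. Qed.

Lemma dotNN {R : realType} {n : nat} (u v : 'rV[R]_n) :
  dot (- u) (- v) = dot u v.
Proof. by rewrite dotNl dotC dotNl opprK dotC. Qed.

Lemma sqr_norm_le_dot {R : realType} {n : nat} (u : 'rV[R]_n) :
  `|u| ^+ 2 <= dot u u.
Proof.
have dot0 : 0 <= dot u u by apply: sumr_ge0 => i _; rewrite -expr2 sqr_ge0.
rewrite -[leRHS]sqr_sqrtr // ler_sqr ?nnegrE ?sqrtr_ge0 //.
apply: rV_norm_ler => [|i]; first exact: sqrtr_ge0.
rewrite -sqrtr_sqr ler_sqrt // /dot (bigD1 i) //= -expr2 lerDl.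
by apply: sumr_ge0 => j _; rewrite -expr2 sqr_ge0.
Qed.

Lemma dot_ge0 {R : realType} {n : nat} (u : 'rV[R]_n) : 0 <= dot u u.
Proof. exact: le_trans (sqr_ge0 _) (sqr_norm_le_dot _). Qed.

Lemma dot_eq0 {R : realType} {n : nat} (u : 'rV[R]_n) : dot u u = 0 -> u = 0.
Proof.
move=> u0; have := sqr_norm_le_dot u; rewrite u0 => u2.
by apply/eqP; rewrite -normr_eq0 -sqrf_eq0 eq_le u2 sqr_ge0.
Qed.

Lemma ler_norm_dot {R : realType} {n : nat} (u v : 'rV[R]_n) :
  `|dot u v| <= n%:R * (`|u| * `|v|).
Proof.
apply: (le_trans (ler_norm_sum _ _ _)).
rewrite -[n in n%:R]card_ord mulr_natl -sumr_const; apply: ler_sum => i _.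
by rewrite normrM ler_pM ?ler_coord_norm.
Qed.

Lemma enorm_sqr {R : realType} {n : nat} (u : 'rV[R]_n) :
  enorm u ^+ 2 = dot u u.
Proof. by rewrite sqr_sqrtr ?dot_ge0. Qed.

Lemma norm_le_enorm {R : realType} {n : nat} (u : 'rV[R]_n) : `|u| <= enorm u.
Proof.
by rewrite -(@ler_sqr R) ?nnegrE ?sqrtr_ge0 // enorm_sqr sqr_norm_le_dot.
Qed.

Lemma enorm_le_norm {R : realType} {n : nat} (u : 'rV[R]_n) :
  enorm u <= n%:R * `|u|.
Proof.
rewrite -(@ler_sqr R) ?nnegrE ?sqrtr_ge0 ?mulr_ge0 // enorm_sqr.
apply: le_trans (ler_norm _) _; apply: le_trans (ler_norm_dot _ _) _.
rewrite exprMn -expr2 ler_wpM2r ?sqr_ge0 //.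
by rewrite expr2 -natrM ler_nat; case: n u => // n _; rewrite leq_pmulr.
Qed.

Lemma edist0 {R : realType} {n : nat} (x : 'rV[R]_n) : Defs.edist 0 x = enorm x.
Proof. by rewrite /Defs.edist /enorm sub0r dotNN. Qed.

Lemma continuous_dot {R : realType} {n : nat} (T : topologicalType)
    (f g : T -> 'rV[R]_n) (x : T) :
  {for x, continuous f} -> {for x, continuous g} ->
  {for x, continuous (fun y => dot (f y) (g y))}.
Proof.
move=> cf cg; rewrite /dot.
have coord (h : T -> 'rV[R]_n) i : {for x, continuous h} ->
    h y 0 i @[y --> x] --> h x 0 i.
  move=> ch.
  apply: (@continuous_comp _ _ _ h (fun M : 'rV[R]_n => M 0 i)) => //.
  exact: coord_continuous.
apply: (@cvg_big R 'I_n +%R 0 predT add_continuous) => i _.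
by apply: cvgM; exact: coord.
Qed.

Lemma is_derive_coord {R : realType} {n : nat} (f : R -> 'rV[R]_n) (t : R)
    (df : 'rV[R]_n) (i : 'I_n) :
  is_derive t 1 f df -> is_derive t 1 (fun s => f s 0 i) (df 0 i).
Proof.
move=> [fd fe]; have := fd; rewrite derivable_mxP => fdi.
apply: DeriveDef; first exact: fdi.
by rewrite -fe derive_mx // mxE.
Qed.

Lemma is_derive_dot {R : realType} {n : nat} (f g : R -> 'rV[R]_n) (t : R)
    (df dg : 'rV[R]_n) :
  is_derive t 1 f df -> is_derive t 1 g dg ->
  is_derive t 1 (fun s => dot (f s) (g s)) (dot df (g t) + dot (f t) dg).
Proof.
move=> f' g'.
have -> : (fun s => dot (f s) (g s)) =
    \sum_(i < n) ((fun s => f s 0 i) * (fun s => g s 0 i)).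
  by apply/funext => s; rewrite fct_sumE.
apply: (is_derive_eq (is_derive_sum (fun i =>
  is_deriveM (is_derive_coord _ _ _ i f') (is_derive_coord _ _ _ i g')))).
rewrite addrC -big_split /=; apply: eq_bigr => i _.
by rewrite /GRing.scale /= mulrC [X in _ + X]mulrC.
Qed.

(** * Components of open sets *)

Lemma segment_in_ball {R : realType} {V : normedModType R} (x y z : V)
    (e t : R) :
  ball x e y -> ball x e z -> 0 <= t <= 1 -> ball x e (y + t *: (z - y)).
Proof.
rewrite -!ball_normE /= => xy xz /andP[t0 t1].
have -> : x - (y + t *: (z - y)) = (1 - t) *: (x - y) + t *: (x - z).
  have -> : z - y = (x - y) - (x - z) by rewrite opprB [RHS]addrC addrA subrK.
  rewrite opprD addrA; move: (x - y) (x - z) => a b.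
  by rewrite scalerBr scalerBl scale1r opprB [LHS]addrA addrAC.
apply: le_lt_trans (ler_normD _ _) _; rewrite !normrZ ger0_norm ?subr_ge0 //.
rewrite [`|t|]ger0_norm //.
(* The strict inequality will come from the second summand, whose weight vanishes at [t = 0]. *)
have [->|tpos] := eqVneq t 0; first by rewrite subr0 mul0r addr0 mul1r.
have tgt0 : 0 < t by rewrite lt_neqAle eq_sym tpos.
have -> : e = (1 - t) * e + t * e by rewrite -mulrDl subrK mul1r.
apply: ler_ltD; first by rewrite ler_wpM2l ?subr_ge0 // ltW.
by rewrite ltr_pM2l.
Qed.

Lemma continuous_segment {R : realType} {V : normedModType R} (y v : V) :
  continuous (fun t : R => y + t *: v).
Proof.
move=> t; apply: cvgD; first exact: cvg_cst.
by apply: cvgZr_tmp; exact: cvg_id.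
Qed.

Lemma segment_connected_component {R : realType} {V : normedModType R}
    (A : set V) (y z : V) :
  (forall t : R, 0 <= t <= 1 -> A (y + t *: (z - y))) ->
  connected_component A y z.
Proof.
move=> seg; exists ((fun t : R => y + t *: (z - y)) @` `[0, 1]).
  split.
  - by exists 0; rewrite ?scale0r ?addr0 //= in_itv /= lexx ler01.
  - by move=> _ [t + <-]; rewrite /= in_itv; exact: seg.
  - apply: connected_continuous_connected; first exact: segment_connected.
    exact/continuous_subspaceT/continuous_segment.
by exists 1; rewrite ?scale1r ?subrKC //= in_itv /= lexx ler01.
Qed.

Lemma component_nbhs {R : realType} {V : normedModType R} (A : set V) (x : V) :
  open A -> A x -> nbhs x (connected_component A x).
Proof.
move=> oA Ax; have /nbhs_ballP[e e0 eA] := open_nbhs_nbhs (conj oA Ax).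
apply/nbhs_ballP; exists e => // y xy.
apply: segment_connected_component => t t01; apply: eA.
by apply: segment_in_ball => //; exact: ballxx.
Qed.

(* The two pieces of a concatenated path are glued without a case distinction:
   min (2t) 1 runs along the path first, then max (2t - 1) 0 along the
   segment. *)
Lemma component_path {R : realType} {V : normedModType R} (A : set V)
    (x y : V) :
  open A -> A x -> connected_component A x y ->
  exists gamma : R -> V, [/\ continuous gamma, gamma 0 = x, gamma 1 = y &
    forall t, 0 <= t <= 1 -> A (gamma t)].
Proof.
move=> oA Ax.
(* [P] and its complement in [A] are both open because balls are convex; hence the connected
   component of [x], which meets [P], lies in [P]. *)
set P := [set y | exists gamma : R -> V, [/\ continuous gamma, gamma 0 = x,
  gamma 1 = y & forall t, 0 <= t <= 1 -> A (gamma t)]].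
have extend u v : P u -> (forall t : R, 0 <= t <= 1 -> A (u + t *: (v - u))) ->
    P v.
  move=> [g [cg g0 g1 gA]] seg.
  exists (fun t => g (Num.min (2 * t) 1) + (Num.max (2 * t - 1) 0) *: (v - u)).
  have c2 : continuous (fun t : R => 2 * t).
    by move=> t; apply: cvgM; [exact: cvg_cst|exact: cvg_id].
  split.
  - move=> t; apply: cvgD.
      apply: (@continuous_comp _ _ _ (fun t : R => Num.min (2 * t) 1) g).
        by apply: continuous_min; [exact: c2|exact: cvg_cst].
      exact: cg.
    apply: cvgZr_tmp; apply: (@continuous_max _ _ (fun t : R => 2 * t - 1)).
      by apply: cvgB; [exact: c2|exact: cvg_cst].
    exact: cvg_cst.
  - by rewrite mulr0 min_l ?ler01 // sub0r max_r ?scale0r ?addr0 //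
       ?lerN10.
  - rewrite mulr1 min_r ?ler1n // g1 max_l; last by rewrite subr_ge0 ler1n.
    by rewrite -[1 in X in X *: _]/(1%:R) -natrB // scale1r subrKC.
  - move=> t /andP[t0 t1].
    have [t2|t2] := leP (2 * t) 1.
      rewrite max_r ?subr_le0 // scale0r addr0; apply: gA.
      by rewrite t2 mulr_ge0.
    rewrite max_l ?subr_ge0 1?ltW // g1; apply: seg.
    by apply/andP; split; lra.
have oP : open P.
  rewrite openE => z Pz; have [g [_ _ g1 gA]] := Pz.
  have Az : A z by rewrite -g1; apply: gA; rewrite ler01 lexx.
  have /nbhs_ballP[e e0 eA] := open_nbhs_nbhs (conj oA Az).
  apply/nbhs_ballP; exists e => // w zw; apply: (extend z) => // t t01.
  by apply: eA; apply: segment_in_ball => //; exact: ballxx.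
have oAP : open (A `\` P).
  rewrite openE => z [Az NPz].
  have /nbhs_ballP[e e0 eA] := open_nbhs_nbhs (conj oA Az).
  apply/nbhs_ballP; exists e => // w zw; split; first exact: eA.
  apply: contra_not NPz => Pw; apply: (extend w) => // t t01.
  by apply: eA; apply: segment_in_ball => //; exact: ballxx.
have Px : P x.
  exists (fun=> x); split => //; first by move=> ?; exact: cvg_cst.
set C := connected_component A x => Cy.
suff CP : C `&` P = C by move: Cy; rewrite -CP => -[].
apply: component_connected.
- by exists x; split => //; exact: connected_component_refl.
- by exists P.
- exists (~` (A `\` P)); first exact: open_closedC.
  apply/seteqP; split => z [Cz]; first by move=> Pz; split => // -[].
  move=> AP; split => //; apply: contrapT => NPz; apply: AP.
  by split => //; exact: connected_component_sub Cz.
Qed.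

(** Components of an open set are open, and all points of one component agree on whether it is
    bounded. *)
Lemma internal_component_open {R : realType} {n : nat} (H : set 'rV[R]_n) :
  compact H -> open (internal_component H).
Proof.
move=> /(compact_closed (@norm_hausdorff _ _)) /closed_openC oH.
rewrite openE => x [Hx bx].
apply: filterS (component_nbhs _ _ oH Hx) => y xy; split.
  exact: connected_component_sub xy.
by rewrite -(same_connected_component xy).
Qed.

(** The complement is the union of the unbounded components, each of which is open. *)
Lemma closure_internal_closed {R : realType} {n : nat} (H : set 'rV[R]_n) :
  compact H -> closed (H `|` internal_component H).
Proof.
move=> cH; have cl := compact_closed (@norm_hausdorff _ _) cH.
rewrite -openC openE => x; rewrite setCU => -[Hx Ix].
apply: filterS (component_nbhs _ _ (closed_openC cl) Hx) => y xy; split.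
  exact: connected_component_sub xy.
move=> [_ by_]; apply: Ix; split => //.
by rewrite (same_connected_component xy).
Qed.

(** Otherwise the ray from [x] away from the origin would avoid [H] and run inside a bounded
    component. *)
Lemma internal_component_norm_lt {R : realType} {n : nat} (H : set 'rV[R]_n)
    (r : R) :
  0 < r -> (forall x, H x -> `|x| < r) ->
  forall x, internal_component H x -> `|x| < r.
Proof.
move=> r0 Hr x [_ [M [_ bM]]]; rewrite ltNge; apply/negP => rx.
have x0 : 0 < `|x| := lt_le_trans r0 rx.
(* The end point [s *: x] has norm |M| + 1 + |x|, beyond the bound |M| + 1 on the component. *)
pose s := (`|M| + 1) / `|x| + 1.
have s0 : 0 <= (`|M| + 1) / `|x| by rewrite divr_ge0 ?addr_ge0.
have ray : connected_component (~` H) x (x + (s *: x - x)).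
  rewrite subrKC; apply: segment_connected_component => t /andP[t0 t1] /Hr.
  have -> : x + t *: (s *: x - x) = (1 + t * (s - 1)) *: x.
    by rewrite scalerDl scale1r -scalerA scalerBl scale1r.
  rewrite normrZ ltNge => /negP; apply; apply: le_trans rx _.
  have k0 : 0 <= t * (s - 1) by rewrite mulr_ge0 // /s addrK.
  by rewrite ger0_norm ?addr_ge0 // ler_peMl // lerDl.
have := bM (`|M| + 1).
rewrite (le_lt_trans (ler_norm M)) ?ltrDl // => /(_ isT _ ray).
rewrite subrKC /= normrZ ger0_norm ?addr_ge0 //.
by rewrite mulrDl mul1r divfK ?gt_eqF // leNgt ltrDl x0.
Qed.

(** The component of 0 is path connected, so a point of it farther than [diam H] from 0 would be
    reached by a path that misses [H]. *)
Lemma bounds_internal_component {R : realType} {n : nat} (H : set 'rV[R]_n) :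
  compact H -> bounds H 0 -> internal_component H 0.
Proof.
move=> cH [H0 Hb]; split => //.
have oH := closed_openC (compact_closed (@norm_hausdorff _ _) cH).
exists (diam H); split; first exact: num_real.
move=> M diamM y /(component_path _ _ _ oH H0)[g [cg g0 g1 gH]].
rewrite /= (le_trans (norm_le_enorm y)) // leNgt; apply/negP => My.
have [||//|//|t] := Hb y g.
- by rewrite edist0 (lt_trans diamM).
- exact: continuous_subspaceT.
- by rewrite in_itv => /gH.
Qed.

(** * Derivatives along curves *)

(** A first-order expansion with error e|h| is easier to produce and to combine than a difference
    quotient, and it allows [h = 0]. *)
Lemma is_derive1P {R : realType} {V : normedModType R} (x : R -> V) (t : R)
    (d : V) :
  is_derive t 1 x d <->
  forall e, 0 < e -> exists2 del, 0 < del &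
    forall h, `|h| < del -> `|x (t + h) - x t - h *: d| <= e * `|h|.
Proof.
split=> [[dx xd] e e0|H].
  have /cvgrPdist_le/(_ _ e0)/nbhs_ballP[del del0 H] :
    h^-1 *: ((x \o shift t) (h *: 1) - x t) @[h --> 0^'] --> d.
    by rewrite -xd; exact: dx.
  exists del => // h hdel.
  have [->|h0] := eqVneq h 0.
    by rewrite addr0 subrr scale0r subr0 !normr0 mulr0.
  have := H h; rewrite -ball_normE /= sub0r normrN => /(_ hdel h0).
  rewrite /= [h *: 1]mulr1 (addrC h) => {}H.
  have -> : x (t + h) - x t - h *: d =
      - (h *: (d - h^-1 *: (x (t + h) - x t))).
    by rewrite scalerBr scalerA mulfV // scale1r opprB.
  by rewrite normrN normrZ mulrC ler_wpM2r.
have D : h^-1 *: ((x \o shift t) (h *: 1) - x t) @[h --> 0^'] --> d.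
  apply/cvgrPdist_le => e e0; have [del del0 {}H] := H _ e0.
  apply/nbhs_ballP; exists del => // h; rewrite -ball_normE /= sub0r normrN.
  move=> /H {}H h0; rewrite [h *: 1]mulr1 (addrC h).
  have -> : d - h^-1 *: (x (t + h) - x t) =
      - (h^-1 *: (x (t + h) - x t - h *: d)).
    by rewrite [in RHS]scalerBr scalerA mulVf // scale1r opprB.
  rewrite normrN normrZ normfV mulrC ler_pdivrMr ?normr_gt0 //.
by split; [apply/cvg_ex; exists d|exact/cvg_lim].
Qed.

Lemma is_derive_ge0_right {R : realType} (v : R -> R) (t d : R) :
  is_derive t 1 v d -> (\forall s \near t^'+, v t <= v s) -> 0 <= d.
Proof.
move=> /is_derive1P vd /nbhs_ballP[del del0 vt].
rewrite leNgt; apply/negP => d0.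
have [|eta eta0 {}vd] := vd (- d / 2); first by rewrite divr_gt0 ?oppr_gt0.
(* With an error of at most (-d/2)h, the increment of [v] over [h] is at most hd/2 < 0. *)
pose h := Num.min del eta / 2.
have m0 : 0 < Num.min del eta by rewrite lt_min del0.
have h0 : 0 < h by rewrite divr_gt0.
have hm : h < Num.min del eta by rewrite /h; lra.
move: hm; rewrite lt_min => /andP[hdel heta].
have := vd h; rewrite gtr0_norm // => /(_ heta) /ler_normlW.
have := vt (t + h); rewrite -ball_normE /= opprD addNKr normrN gtr0_norm //.
rewrite ltrDl => /(_ hdel h0); rewrite /GRing.scale /= => {}vt.
have : h * d < 0 by rewrite nmulr_llt0.
lra.
Qed.

Lemma is_derive_loc_min {R : realType} (v : R -> R) (t d : R) :
  is_derive t 1 v d -> (\forall s \near t, v t <= v s) -> d = 0.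
Proof.
move=> vd vt; apply/eqP; rewrite eq_le -oppr_ge0; apply/andP; split; last first.
  by apply: is_derive_ge0_right vd _; exact: cvg_within.
(* Reflection at [t] negates the derivative and turns the left half of the minimum into the right
   half. *)
pose u s := v (2 * t - s).
have u' : is_derive t 1 u (- d).
  apply/is_derive1P => e /(proj1 (is_derive1P _ _ _) vd)[del del0 H].
  exists del => // h; rewrite -(normrN h) => /H; rewrite /u.
  have -> : 2 * t - (t + h) = t - h by ring.
  have -> : 2 * t - t = t by ring.
  by rewrite scaleNr scalerN.
apply: is_derive_ge0_right u' _.
have /nbhs_ballP[del del0 H] := vt.
apply/nbhs_ballP; exists del => // s; rewrite -ball_normE /= => ts _.
rewrite {1}/u (_ : 2 * t - t = t); last by ring.
apply: H; rewrite -ball_normE /= (_ : t - _ = - (t - s)); last by ring.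
by rewrite normrN.
Qed.

Lemma is_derive_line {R : realType} {V W : normedModType R} (f : V -> W)
    (y v : V) (t : R) :
  differentiable f (y + t *: v) ->
  is_derive t 1 (fun s => f (y + s *: v)) ('d f (y + t *: v) v).
Proof.
move=> df; have := @diff_derivable _ _ _ f _ v df; rewrite -(deriveE _ df).
rewrite /derivable /derive => dv.
suff E : (fun h : R => h^-1 *: (((fun s => f (y + s *: v)) \o shift t) (h *: 1)
      - f (y + t *: v))) =
    (fun h : R => h^-1 *: ((f \o shift (y + t *: v)) (h *: v)
      - f (y + t *: v))).
  by apply: DeriveDef; rewrite /derivable /derive E.
apply/funext => h /=; congr (_ *: (f _ - _)).
by rewrite [h *: 1]mulr1 scalerDl addrCA.
Qed.

(** * Proximal normals *)

(** Along a curve of [H] through [z], the squared distance to the centre [z + w] is minimal at [z];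
    its derivative there is -2 [dot w v]. *)
Lemma tangent_orthogonal {R : realType} {n : nat} (H : set 'rV[R]_n)
    (z w v : 'rV[R]_n) :
  (forall y, H y -> dot w w <= dot (z + w - y) (z + w - y)) ->
  tangent_vector H z v -> dot w v = 0.
Proof.
move=> Hw [g [g0 gH g']].
have d' : is_derive (0 : R) 1 (fun s => z + w - g s) (- v).
  apply/is_derive1P => e /(proj1 (is_derive1P _ _ _) g')[del del0 {}g'].
  exists del => // h /g'; rewrite -normrN; congr (_ <= _); congr `|_|.
  move: (z + w) => a.
  by rewrite scalerN opprK !opprD !opprK addrACA subrr (add0r (_ + g 0)).
have := is_derive_loc_min _ _ _ (is_derive_dot _ _ _ _ _ d' d').
rewrite g0 addrAC subrr add0r => min0.
have {min0} : dot (- v) w + dot w (- v) = 0.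
  by apply: min0; apply: filterS gH => s /Hw.
by rewrite dotC -scaleN1r dotZr; lra.
Qed.

(** Chain rule for [psi \o phi], which is the identity near [z]. *)
Lemma diff_left_inverse {R : realType} {n m : nat}
    (phi : 'rV[R]_n -> 'rV[R]_m) (psi : 'rV[R]_m -> 'rV[R]_n)
    (z v : 'rV[R]_n) :
  differentiable phi z -> differentiable psi (phi z) ->
  (\forall x \near z, psi (phi x) = x) ->
  'd psi (phi z) ('d phi z v) = v.
Proof.
move=> dphi dpsi psiK.
have -> : 'd psi (phi z) ('d phi z v) = 'd (psi \o phi) z v.
  by rewrite (diff_comp dphi dpsi).
rewrite -deriveE; last exact: differentiable_comp.
by rewrite (near_eq_derive _ psiK) derive_id.
Qed.

(** The inverse chart carries the [j]-th coordinate line of the slice to a curve in [H]. *)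
Lemma chart_tangent {R : realType} {m : nat} (H U V : set 'rV[R]_m.+1)
    (phi psi : 'rV[R]_m.+1 -> 'rV[R]_m.+1) (z : 'rV[R]_m.+1) (j : 'I_m.+1) :
  diffeomorphism U V phi psi -> U z -> H z ->
  (forall x, U x ->
     (H x <-> forall k : 'I_m.+1, (m <= k)%N -> phi x 0 k = 0)) ->
  (j < m)%N ->
  tangent_vector H z ('d psi (phi z) (delta_mx 0 j)).
Proof.
move=> [oU oV sphi spsi [UV VU]] Uz Hz chart jm.
have [Vz psiK] := UV _ Uz.
have dpsi : differentiable psi (phi z) by have [/(_ _ Vz)] := spsi 1%N.
pose aff (s : R) : 'rV[R]_m.+1 := phi z + s *: delta_mx 0 j.
have aff0 : aff 0 = phi z by rewrite /aff scale0r addr0.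
exists (psi \o aff); split.
- by rewrite /= aff0.
- have Vaff : \forall s \near (0 : R), V (aff s).
    have := continuous_segment (phi z) (delta_mx 0 j) (0 : R).
    by apply; rewrite scale0r addr0; exact: open_nbhs_nbhs.
  apply: filterS Vaff => s Vs; have [Us phiK] := VU _ Vs.
  apply/chart => // k mk; rewrite /= phiK /aff !mxE.
  rewrite (proj1 (chart _ Uz)) //.
  have /negPf -> : k != j by rewrite -val_eqE /= gtn_eqF // (leq_trans jm).
  by rewrite andbF mulr0 addr0.
- have := is_derive_line psi (phi z) (delta_mx 0 j) 0.
  by rewrite scale0r addr0; apply.
Qed.

Lemma dot_linear_last {R : realType} {m : nat}
    (L : {linear 'rV[R]_m.+1 -> 'rV[R]_m.+1}) (w : 'rV[R]_m.+1) :
  (forall j : 'I_m.+1, (j < m)%N -> dot w (L (delta_mx 0 j)) = 0) ->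
  forall y, dot w (L y) = y 0 ord_max * dot w (L (delta_mx 0 ord_max)).
Proof.
move=> Lw y; rewrite {1}(row_sum_delta y) linear_sum /=.
have dot_sum (F : 'I_m.+1 -> 'rV[R]_m.+1) :
    dot w (\sum_j F j) = \sum_j dot w (F j).
  rewrite /dot exchange_big /=; apply: eq_bigr => i _.
  by rewrite summxE mulr_sumr.
rewrite dot_sum (bigD1 ord_max) //= big1 ?addr0 => [|j jm].
  by rewrite linearZ dotZr.
rewrite linearZ dotZr Lw ?mulr0 //.
by rewrite ltn_neqAle -ltnS ltn_ord andbT.
Qed.

(* In a chart, v = L (M v) where L maps the first m basis vectors to tangent
   vectors; so dot w v only sees the last coordinate of M v. *)
Lemma normal_space_line {R : realType} {m : nat} (H : set 'rV[R]_m.+1)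
    (z : 'rV[R]_m.+1) :
  smooth_submanifold m H -> H z ->
  exists (l : 'rV[R]_m.+1 -> R) (u : 'rV[R]_m.+1),
    forall w, (forall v, tangent_vector H z v -> dot w v = 0) ->
    forall v, dot w v = l v * dot w u.
Proof.
move=> sm Hz; have [U [V [phi [psi [D Uz chart]]]]] := sm z Hz.
have [oU oV sphi spsi [UV VU]] := D; have [Vz psiK] := UV _ Uz.
exists (fun v => 'd phi z v 0 ord_max), ('d psi (phi z) (delta_mx 0 ord_max)).
move=> w ww v.
have dphi : differentiable phi z by have [/(_ _ Uz)] := sphi 1%N.
have dpsi : differentiable psi (phi z) by have [/(_ _ Vz)] := spsi 1%N.
have K : \forall x \near z, psi (phi x) = x.
  by apply: filterS (open_nbhs_nbhs (conj oU Uz)) => x /UV [].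
rewrite -dot_linear_last.
  by rewrite (diff_left_inverse _ _ _ v dphi dpsi K).
move=> j jm; apply: ww.
exact: (chart_tangent _ _ _ _ _ _ _ D Uz Hz chart jm).
Qed.

(** Both [w] and [N z] are orthogonal to all tangent vectors, hence [w] is a multiple of [N z]. The
    factor is not positive: the points [z + t *: N z] are internal for small [t] and must not enter
    the ball about [z + w]. *)
Lemma proximal_normal_le0 {R : realType} {m : nat} (H : set 'rV[R]_m.+1)
    (N : 'rV[R]_m.+1 -> 'rV[R]_m.+1) (z w v : 'rV[R]_m.+1) :
  smooth_submanifold m H -> inner_unit_normal H N -> H z ->
  (forall y, (H `|` internal_component H) y ->
     dot w w <= dot (z + w - y) (z + w - y)) ->
  0 <= dot (N z) v -> dot w v <= 0.
Proof.
move=> sm /(_ z) nN Hz Hw Nv; have [N1 Nt NI] := nN Hz.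
have wt u : tangent_vector H z u -> dot w u = 0.
  by apply: tangent_orthogonal => y Hy; apply: Hw; left.
have [l [u lu]] := normal_space_line H z sm Hz.
have NN : dot (N z) (N z) = 1 by rewrite -enorm_sqr N1 expr1n.
have wN : dot w v = dot w (N z) * dot (N z) v.
  (* At [v = N z] the formula reads [1 = l (N z) * dot (N z) u]; this factor is inserted on the
     left. *)
  have := lu _ Nt (N z); rewrite NN => lN.
  rewrite (lu _ wt v) (lu _ wt (N z)) (lu _ Nt v).
  by rewrite mulrACA (mulrC _ (dot w u)) -[LHS]mulr1 lN mulrACA mulrC; ring.
rewrite wN mulr_le0_ge0 // leNgt; apply/negP => wN0.
near (0 : R)^'+ => t.
have t0 : 0 < t by [].
have := Hw (z + t *: N z); rewrite (_ : z + w - _ = w - t *: N z); last first.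
  by rewrite opprD addrACA subrr add0r.
have It : internal_component H (z + t *: N z) by near: t.
move=> /(_ (or_intror It)).
(* The squared distance expands to |w|^2 - 2t<w, N z> + t^2, which is below |w|^2 once 0 < t < <w, N
   z>. *)
rewrite !(dotBl, dotBr, dotZl, dotZr) (dotC (N z) w) NN mulr1.
have tw : t < dot w (N z) by near: t; exact: nbhs_right_lt.
have : t * t < t * dot w (N z) by rewrite ltr_pM2l.
move: (mulr_gt0 t0 wN0); lra.
Unshelve. all: by end_near. Qed.

(** * Invariance of proximal sets *)

Lemma is_derive_continuous {R : realType} {V : normedModType R} (f : R -> V)
    (t : R) (d : V) :
  is_derive t 1 f d -> {for t, continuous f}.
Proof. by move=> [df _]; exact/differentiable_continuous/derivable1_diffP. Qed.

Lemma is_derive_expRMl {R : realType} (a t : R) :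
  is_derive t 1 (fun s => expR (a * s)) (a * expR (a * t)).
Proof.
have Da : is_derive t 1 (fun s : R => a * s) a.
  apply/is_derive1P => e e0; exists 1 => // h _; rewrite /GRing.scale /=.
  rewrite (_ : a * (t + h) - a * t - h * a = 0); last by ring.
  by rewrite normr0 mulr_ge0 ?(ltW e0).
have := is_derive1_comp (is_derive_expR (a * t)) Da.
by rewrite /GRing.scale /= mulrC.
Qed.

(** With u = y - p and v = p - z, |u + v|^2 - |v|^2 = <u, u + 2v>. The constant is uniform in [z]
    over a bounded set. *)
Lemma dot_sub_lipschitz {R : realType} {n : nat} (p y z : 'rV[R]_n) (B : R) :
  `|z| <= B -> `|y - p| <= 1 ->
  `|dot (y - z) (y - z) - dot (p - z) (p - z)| <=
    n%:R * (1 + 2 * `|p| + 2 * B) * `|y - p|.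
Proof.
move=> zB yp.
have -> : dot (y - z) (y - z) - dot (p - z) (p - z) =
    dot (y - p) ((y - p) + (2 *: p - 2 *: z)).
  have -> : y - z = (y - p) + (p - z) by rewrite addrA subrK.
  move: (y - p) => u; rewrite -scalerBr; move: (p - z) => v.
  by rewrite !(dotDl, dotDr, dotZr) (dotC v u); ring.
apply: (le_trans (ler_norm_dot _ _)).
rewrite -mulrA ler_wpM2l // mulrC ler_wpM2r //.
apply: (le_trans (ler_normD _ _)); rewrite -addrA lerD //.
apply: (le_trans (ler_normB _ _)); rewrite !normrZ ger0_norm //.
by rewrite lerD2l ler_wpM2l.
Qed.

Lemma continuous_subl {R : realType} {V : normedModType R} (y : V) :
  continuous (fun z => y - z).
Proof. by move=> z; apply: cvgB; [exact: cvg_cst|exact: cvg_id]. Qed.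

Lemma nearest_point {R : realType} {n : nat} (K : set 'rV[R]_n) (y : 'rV[R]_n) :
  compact K -> K !=set0 ->
  exists2 z, K z &
    forall z', K z' -> dot (y - z) (y - z) <= dot (y - z') (y - z').
Proof.
move=> cK K0.
have [|z zK zmin] := @EVT_min_rV R n (fun z => dot (y - z) (y - z)) K K0 cK.
- apply: continuous_subspaceT => z.
  exact: (continuous_dot _ _ _ z (continuous_subl y z) (continuous_subl y z)).
- exists z; first by rewrite inE in zK.
  by move=> z' Kz'; apply: zmin; rewrite inE.
Qed.

Lemma continuous_eps_delta {R : realType} {V W : normedModType R} (f : V -> W) :
  (forall p e, 0 < e -> exists2 d, 0 < d &
     forall y, `|y - p| < d -> `|f p - f y| <= e) ->
  continuous f.
Proof.
move=> H p; apply/cvgrPdist_le => e /(H p)[d d0 {}H].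
by apply/nbhs_ballP; exists d => // y; rewrite -ball_normE /= distrC; exact: H.
Qed.

(** The nearest point [pr y] is merely chosen and may jump; the minimum is still continuous, as the
    squared distances to the points of [K] satisfy one Lipschitz bound near [p]. *)
Lemma continuous_sqr_dist {R : realType} {n : nat} (K : set 'rV[R]_n)
    (pr : 'rV[R]_n -> 'rV[R]_n) :
  compact K -> (forall y, K (pr y)) ->
  (forall y z, K z -> dot (y - pr y) (y - pr y) <= dot (y - z) (y - z)) ->
  continuous (fun y : 'rV[R]_n => dot (y - pr y) (y - pr y)).
Proof.
move=> /compact_bounded[B [_ KB]] Kpr prmin.
apply: continuous_eps_delta => p e e0.
have {}KB z : K z -> `|z| <= `|B| + 1.
  by apply: KB; rewrite (le_lt_trans (ler_norm B)) // ltrDl.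
set C := n%:R * (1 + 2 * `|p| + 2 * (`|B| + 1)) + 1.
have C0 : 0 < C by rewrite ltr_wpDl // !(mulr_ge0, addr_ge0).
exists (Num.min 1 (e / C)); first by rewrite lt_min ltr01 divr_gt0.
move=> y; rewrite lt_min => /andP[/ltW y1 ye].
have Ce : C * `|y - p| <= e by rewrite mulrC -ler_pdivlMr // ltW.
have lip z : K z ->
    `|dot (y - z) (y - z) - dot (p - z) (p - z)| <= C * `|y - p|.
  move=> /KB zB; apply: le_trans (dot_sub_lipschitz _ _ _ _ zB y1) _.
  by rewrite ler_wpM2r // lerDl.
(* Each minimum is tested with the point nearest to the other argument. *)
apply/ler_normlP; split.
  have := lip _ (Kpr p) => /ler_normlP[_].
  have := prmin y _ (Kpr p); lra.
have := lip _ (Kpr y) => /ler_normlP[+ _].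
have := prmin p _ (Kpr y); lra.
Qed.

(* The squared distance u to K satisfies a differential inequality u' <= 2 L u
   in the sense of upper right Dini derivatives.  It is exploited at the last
   time t0 where expR (- 2 L s) * u - eps * s is nonpositive, by comparing u
   with the squared distance to the point of K nearest to x t0. *)
Lemma proximal_invariance {R : realType} {n : nat} (K : set 'rV[R]_n)
    (F : 'rV[R]_n -> 'rV[R]_n) (x : R -> 'rV[R]_n) (L r : R) :
  compact K -> 0 <= L -> 0 < r ->
  (forall z w, K z ->
     (forall y, K y -> dot w w <= dot (z + w - y) (z + w - y)) ->
     dot w (F z) <= 0) ->
  (forall z y, K z -> dot (y - z) (y - z) <= r ->
     dot (y - z) (F y - F z) <= L * dot (y - z) (y - z)) ->
  K (x 0) -> (forall t : R, 0 <= t -> is_derive t 1 x (F (x t))) ->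
  forall t, 0 <= t -> K (x t).
Proof.
move=> cK L0 r0 prox lip Kx0 x' t1 t1_ge0.
have K0 : K !=set0 by exists (x 0).
have /choice[pr Kpr] : forall y, exists p, K p /\
    forall z, K z -> dot (y - p) (y - p) <= dot (y - z) (y - z).
  by move=> y; have [z] := nearest_point K y cK K0; exists z.
pose u y := dot (y - pr y) (y - pr y).
have uc : continuous u.
  apply: (continuous_sqr_dist K) => // [y|y z Kz]; first by have [] := Kpr y.
  by have [_] := Kpr y; exact.
have u_ge0 y : 0 <= u y by exact: dot_ge0.
have Ku y : K y -> u y = 0.
  move=> Ky; apply/eqP; rewrite eq_le u_ge0 andbT.
  by have [_ /(_ _ Ky)] := Kpr y; rewrite subrr -(scale0r y) dotZl mul0r.
apply: contrapT => NK.
have u1 : 0 < u (x t1).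
  rewrite lt_neqAle u_ge0 andbT eq_sym; apply/eqP => /dot_eq0/eqP.
  by rewrite subr_eq0 => /eqP E; apply: NK; rewrite E; have [] := Kpr (x t1).
have t1_gt0 : 0 < t1.
  rewrite lt_neqAle t1_ge0 andbT; apply/eqP => E.
  by apply: NK; rewrite -E.
pose a := - (2 * L); pose E1 := expR (a * t1).
have E1_gt0 : 0 < E1 by exact: expR_gt0.
(* [eps] is chosen with [eps * t1 = E1 * m / 2]: then [w] below is positive at [t1], and the cap [r]
   in [m] gives [u (x t0) <= r], where the Lipschitz hypothesis applies. *)
pose m := Num.min (u (x t1)) r.
have m_gt0 : 0 < m by rewrite lt_min u1.
pose eps := E1 * m / (2 * t1).
have eps_gt0 : 0 < eps by rewrite divr_gt0 ?mulr_gt0.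
have eps_t1 : eps * t1 = E1 * m / 2.
  by rewrite /eps; field; rewrite gt_eqF.
clearbody eps.
have m_u1 : m <= u (x t1) by rewrite ge_min lexx.
have m_r : m <= r by rewrite ge_min lexx orbT.
have E1m := mulr_gt0 E1_gt0 m_gt0.
pose w s := expR (a * s) * u (x s) - eps * s.
have wc t : 0 <= t -> {for t, continuous w}.
  move=> t_ge0; apply: cvgB; last first.
    by apply: cvgM; [exact: cvg_cst|exact: cvg_id].
  apply: cvgM; first exact: (is_derive_continuous _ _ _ (is_derive_expRMl a t)).
  apply: (@continuous_comp _ _ _ x u); last exact: uc.
  exact: (is_derive_continuous _ _ _ (x' _ t_ge0)).
pose S := [set s | 0 <= s <= t1 /\ w s <= 0].
have S0 : S 0.
  by split; rewrite ?lexx ?t1_ge0 // /w (Ku _ Kx0) !mulr0 subrr.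
have ubS : ubound S t1 by move=> s [/andP[]].
have supS : has_sup S by split; [exists 0|exists t1].
pose t0 := sup S.
have t0_ge0 : 0 <= t0 by apply: ub_le_sup => //; exists t1.
have t0_le : t0 <= t1 by apply: ge_sup => //; exists 0.
have w_gt0 s : t0 < s -> s <= t1 -> 0 < w s.
  move=> t0s st1; rewrite ltNge; apply/negP => ws.
  have : s <= t0.
    apply: ub_le_sup; first by exists t1.
    by split => //; rewrite (le_trans t0_ge0 (ltW t0s)).
  by rewrite leNgt t0s.
(* By continuity the supremum belongs to [S]: otherwise [w] would be positive on a left
   neighbourhood of [t0]. *)
have w0 : w t0 <= 0.
  rewrite leNgt; apply/negP => wt0.
  have /cvgrPdist_lt/(_ _ wt0)/nbhs_ballP[del del0 H] := wc _ t0_ge0.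
  have [s [s01 ws] st0] := sup_adherent del0 supS.
  have st : s <= t0 by apply: ub_le_sup => //; exists t1.
  have := H s; rewrite -ball_normE /= ger0_norm ?subr_ge0 // ltrBlDl -ltrBlDr.
  by move=> /(_ st0) /ltr_normlW; rewrite ltrBlDl ltrDr ltNge ws.
have t0_lt : t0 < t1.
  rewrite lt_neqAle t0_le andbT; apply/eqP => E; move: w0.
  rewrite E /w eps_t1 leNgt => /negP; apply; rewrite subr_gt0.
  have : E1 * m <= E1 * u (x t1) by rewrite ler_pM2l.
  rewrite -/E1; move: E1m; lra.
have u0 : u (x t0) <= r.
  have E10 : E1 <= expR (a * t0).
    by rewrite ler_expR /a !mulNr lerN2 ler_wpM2l ?mulr_ge0.
  have : expR (a * t0) * u (x t0) <= expR (a * t0) * r.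
    have : eps * t0 <= eps * t1 by rewrite ler_wpM2l // ltW.
    have : E1 * m <= expR (a * t0) * r.
      by rewrite ler_pM // ltW.
    move: w0; rewrite /w; lra.
  by rewrite ler_pM2l ?expR_gt0.
have [Kz zmin] := Kpr (x t0); set z := pr (x t0) in Kz zmin.
(* With [z] frozen, [D] is differentiable, dominates [u (x s)] and equals it at [t0]. *)
pose D s := dot (x s - z) (x s - z).
have D' : is_derive t0 1 D (2 * dot (x t0 - z) (F (x t0))).
  have xz' : is_derive t0 1 (fun s => x s - z) (F (x t0)).
    rewrite -[F (x t0)]subr0; apply: is_deriveB; exact: x'.
  have := is_derive_dot _ _ _ _ _ xz' xz'.
  by rewrite (dotC (F _)) -mulr2n -[_ *+ 2]mulr_natl.
have v' : is_derive t0 1 (fun s => expR (a * s) * D s - eps * s)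
    (expR (a * t0) * (2 * dot (x t0 - z) (F (x t0)) - 2 * L * D t0) - eps).
  have eD := is_deriveM (is_derive_expRMl a t0) D'.
  have et : is_derive t0 1 (fun s => eps * s) eps.
    have := is_deriveZ eps (is_derive_id t0 1).
    by rewrite /GRing.scale /= mulr1.
  apply: (is_derive_eq (is_deriveB eD et)).
  by rewrite /GRing.scale /= /a; ring.
(* The derivative in [v'] is at most [- eps], yet [t0] is a minimum from the right, because
   [w t0 <= 0 < w s] for [s] after [t0]. *)
have := is_derive_ge0_right _ _ _ v'; rewrite subr_ge0.
(* [F (x t0)] is split into [F z], controlled by the proximal normal [x t0 - z], and a difference
   controlled by [L]. *)
have Dneg : 2 * dot (x t0 - z) (F (x t0)) - 2 * L * D t0 <= 0.
  have Fz : dot (x t0 - z) (F z) <= 0.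
    by apply: prox => // y Ky; rewrite (addrC z) subrK; exact: zmin.
  have := lip z (x t0) Kz u0; rewrite dotBr /D; lra.
have : expR (a * t0) * (2 * dot (x t0 - z) (F (x t0)) - 2 * L * D t0) <= 0.
  by rewrite mulr_ge0_le0 // expR_ge0.
move=> le0 /(_ _) H; suff /H : \forall s \near t0^'+,
    expR (a * t0) * D t0 - eps * t0 <= expR (a * s) * D s - eps * s.
  by rewrite leNgt (le_lt_trans le0).
near=> s.
have t0s : t0 < s by [].
have st1 : s < t1 by near: s; exact: nbhs_right_lt.
rewrite (le_trans w0) // (le_trans (ltW (w_gt0 s t0s (ltW st1)))) //.
by rewrite /w lerD2r ler_pM2l ?expR_gt0 //; have [_] := Kpr (x s); exact.
Unshelve. all: by end_near. Qed.

(** * Existence of solutions *)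

(** If the preimage of [A] were not in [F], that of its complement would be, and a finer filter
    could not contain [A]. *)
Lemma ultra_fmap {T U : Type} (f : T -> U) (F : set_system T) :
  UltraFilter F -> UltraFilter (fmap f F).
Proof.
move=> FU; constructor; first exact: fmap_proper_filter.
move=> G PG FG; apply/seteqP; split => A; last exact: FG.
move=> GA; have [//|FnA] := in_ultra_setVsetC (f @^-1` A) FU.
have [y []] := filter_ex (filterI GA (FG (~` A) FnA)); by [].
Qed.

Definition euler {R : realType} {V : normedModType R} (g : V -> V) (h : R)
  (k : nat) (p : V) : V := iter k (fun q => q + h *: g q) p.

Lemma euler_lipschitz {R : realType} {V : normedModType R} (g : V -> V)
    (M h : R) (k : nat) (p : V) :
  0 <= h -> (forall y, `|g y| <= M) ->
  `|euler g h k p - p| <= M * (h * k%:R).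
Proof.
move=> h0 gM; elim: k => [|k IH]; first by rewrite subrr normr0 !mulr0.
rewrite /euler iterS -/(euler g h k p) addrAC.
apply: (le_trans (ler_normD _ _)).
rewrite normrZ (ger0_norm h0) -natr1 !mulrDr mulr1 lerD //.
by rewrite mulrC ler_wpM2r.
Qed.

(** The bound depends only on the elapsed time hk: the next step adds at most LMh^2 k, and k^2 + k
    <= (k + 1)^2. *)
Lemma euler_taylor {R : realType} {V : normedModType R} (g : V -> V)
    (L M h : R) (k : nat) (p : V) :
  0 <= h -> 0 <= L -> (forall y, `|g y| <= M) ->
  (forall y z, `|g y - g z| <= L * `|y - z|) ->
  `|euler g h k p - p - (h * k%:R) *: g p| <= L * M * (h * k%:R) ^+ 2.
Proof.
move=> h0 L0 gM gL; have M0 : 0 <= M := le_trans (normr_ge0 _) (gM p).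
elim: k => [|k IH].
  by rewrite subrr mulr0 scale0r subrr normr0 expr0n mulr0.
have := euler_lipschitz g M h k p h0 gM.
rewrite /euler iterS -/(euler g h k p); move: (euler g h k p) IH => q IH qp.
have -> : q + h *: g q - p - (h * k.+1%:R) *: g p =
    (q - p - (h * k%:R) *: g p) + h *: (g q - g p).
  rewrite -natr1 mulrDr mulr1 scalerDl scalerBr opprD -!addrA.
  by congr (_ + _); rewrite addrCA; congr (_ + _); rewrite addrCA.
apply: (le_trans (ler_normD _ _)).
rewrite normrZ (ger0_norm h0).
have hq : h * `|g q - g p| <= h * (L * (M * (h * k%:R))).
  rewrite ler_wpM2l //; apply: (le_trans (gL _ _)); exact: ler_wpM2l.
apply: (le_trans (lerD IH hq)).
have LMh : 0 <= L * M * h ^+ 2 by rewrite !mulr_ge0.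
have k0 : 0 <= k%:R :> R by [].
have : 0 <= L * M * h ^+ 2 * (k%:R + 1) by rewrite mulr_ge0 // addr_ge0.
rewrite -natr1; lra.
Qed.

(** [E] is constant between grid points, and the field is autonomous, so [E (t + s)] arises from
    [E t] by [j] more steps. Truncation gives |hj - s| <= h, which costs the term [M * h]. *)
Lemma euler_step {R : realType} {V : normedModType R} (g : V -> V)
    (L M h t s : R) (p : V) (E := fun t => euler g h (Num.truncn (t / h)) p) :
  0 < h -> 0 <= L -> 0 <= t -> 0 <= s -> (forall y, `|g y| <= M) ->
  (forall y z, `|g y - g z| <= L * `|y - z|) ->
  `|E (t + s) - E t - s *: g (E t)| <= L * M * (s + h) ^+ 2 + M * h.
Proof.
move=> h0 L0 t0 s0 gM gL; have M0 : 0 <= M := le_trans (normr_ge0 _) (gM p).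
have ts : (Num.truncn (t / h) <= Num.truncn ((t + s) / h))%N.
  by apply: le_truncn; rewrite ler_pM2r ?invr_gt0 // lerDl.
set m := Num.truncn (t / h) in ts *.
set j := (Num.truncn ((t + s) / h) - m)%N.
have jm : Num.truncn ((t + s) / h) = (j + m)%N by rewrite subnK.
have [sj js] : s - h <= h * j%:R /\ h * j%:R <= s + h.
  have /andP[a1 a2] : m%:R <= t / h < m.+1%:R.
    by apply: truncn_itv; rewrite divr_ge0 // ltW.
  have /andP[] : (j + m)%:R <= (t + s) / h < (j + m).+1%:R.
    by rewrite -jm; apply: truncn_itv; rewrite divr_ge0 ?addr_ge0 // ltW.
  move: a1 a2; rewrite !ler_pdivlMr // !ltr_pdivrMr // -!natr1 natrD.
  by move=> *; split; lra.
have -> : E (t + s) = euler g h j (E t).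
  by rewrite /E jm /euler iterD.
move: (E t) => q.
have -> : euler g h j q - q - s *: g q =
    (euler g h j q - q - (h * j%:R) *: g q) + (h * j%:R - s) *: g q.
  by rewrite scalerBl addrA subrK.
apply: (le_trans (ler_normD _ _)); apply: lerD.
  apply: le_trans (euler_taylor g L M h j q (ltW h0) L0 gM gL) _.
  rewrite ler_wpM2l ?mulr_ge0 // ler_sqr ?nnegrE ?mulr_ge0 ?addr_ge0 //;
    exact: ltW.
rewrite normrZ mulrC ler_pM //.
by rewrite ler_norml; apply/andP; split; lra.
Qed.

(* All Euler approximations are passed to the limit at once along an
   ultrafilter, which avoids proving that they converge. *)
Lemma euler_limit {R : realType} {V : normedModType R} (g : V -> V)
    (L M : R) (p : V) :
  (forall r : R, compact [set v : V | `|v| <= r]) ->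
  0 <= L -> (forall y, `|g y| <= M) ->
  (forall y z, `|g y - g z| <= L * `|y - z|) ->
  exists x : R -> V, x 0 = p /\ forall t s, 0 <= t -> 0 <= s ->
    `|x (t + s) - x t - s *: g (x t)| <= L * M * s ^+ 2.
Proof.
move=> cB L0 gM gL; have M0 : 0 <= M := le_trans (normr_ge0 _) (gM p).
have [F [UF ooF]] := ultraFilterLemma (_ : ProperFilter \oo).
pose h (k : nat) : R := k.+1%:R^-1.
have h_gt0 k : 0 < h k by rewrite invr_gt0.
have hF : h k @[k --> F] --> (0 : R).
  by apply: cvg_trans (@cvg_harmonic R) => A; exact: ooF.
pose y t k := euler g (h k) (Num.truncn (t / h k)) p.
(* At each time the approximations stay in a compact ball, where the image ultrafilter converges. *)
have ycvg (t : R) : exists x : V, 0 <= t -> y t k @[k --> F] --> x.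
  have [t0|] := leP 0 t; last by exists p.
  have := cB (`|p| + M * t); rewrite compact_ultra => /(_ (fmap (y t) F)).
  case; first exact: ultra_fmap.
    suff : \forall k \near F, `|y t k| <= `|p| + M * t by [].
    apply: filterS filterT => k _ /=.
    rewrite -[y t k](subrKC p) (le_trans (ler_normD _ _)) // lerD2l.
    apply: le_trans (euler_lipschitz g M (h k) _ p (ltW (h_gt0 k)) gM) _.
    rewrite ler_wpM2l // mulrC -ler_pdivlMr //.
    by have /andP[] := truncn_itv (divr_ge0 t0 (ltW (h_gt0 k))).
  by move=> z [_ yz]; exists z.
have [x yx] := choice ycvg.
have gc : continuous g.
  apply: continuous_eps_delta => q e e0; exists (e / (L + 1)).
    by rewrite divr_gt0 // ltr_wpDl.
  move=> z; rewrite ltr_pdivlMr ?ltr_wpDl // => /ltW zq.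
  apply: (le_trans (gL _ _)); rewrite distrC; apply: le_trans zq.
  by rewrite mulrC ler_wpM2l // lerDl.
exists x; split.
  apply: (@cvg_unique _ _ (y 0 k @[k --> F])) => //; first exact: yx.
  rewrite (_ : y 0 = fun=> p); first exact: cvg_cst.
  by apply/funext => k; rewrite /y mul0r truncn0.
move=> t s t0 s0.
have l1 : `|y (t + s) k - y t k - s *: g (y t k)| @[k --> F] -->
    `|x (t + s) - x t - s *: g (x t)|.
  apply: cvg_norm; apply: cvgB.
    by apply: cvgB; apply: yx; rewrite ?addr_ge0.
  apply: cvgZl_tmp; apply: continuous_cvg; first exact: gc.
  exact: yx.
have l2 : L * M * (s + h k) ^+ 2 + M * h k @[k --> F] --> L * M * s ^+ 2.
  rewrite -[X in _ --> X]addr0 -[X in _ --> _ + X](mulr0 M).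
  apply: cvgD; last by apply: cvgM; [exact: cvg_cst|].
  apply: cvgM; first exact: cvg_cst.
  have sh : s + h k @[k --> F] --> s.
    by rewrite -[X in _ --> X]addr0; apply: cvgD; [exact: cvg_cst|].
  exact: cvgM.
apply: (ler_cvg_to l1 l2); apply: filterS filterT => k _.
exact: euler_step.
Qed.

(** The quadratic forward estimate of the Euler limit gives right derivatives; recentring it at the
    later time gives left ones. *)
Lemma lipschitz_ode_solution {R : realType} {V : normedModType R} (g : V -> V)
    (L M : R) (p : V) :
  (forall r : R, compact [set v : V | `|v| <= r]) ->
  0 <= L -> (forall y, `|g y| <= M) ->
  (forall y z, `|g y - g z| <= L * `|y - z|) ->
  exists x : R -> V, x 0 = p /\
    forall t : R, 0 <= t -> is_derive t 1 x (g (x t)).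
Proof.
move=> cB L0 gM gL; have M0 : 0 <= M := le_trans (normr_ge0 _) (gM p).
have [x0 [x00 xT]] := euler_limit g L M p cB L0 gM gL.
(* The linear continuation makes the two-sided derivative at 0 exist. *)
pose x (t : R) := if t < 0 then p + t *: g p else x0 t.
have xE t : 0 <= t -> x t = x0 t by rewrite /x ltNge => ->.
exists x; split; first by rewrite xE.
move=> t t0; apply/is_derive1P => e e0.
(* The first term is the forward error, the second the price of replacing [g b] by [g a] in [back],
   and 1 ensures positivity. *)
pose C := L * M + L * (L * M + M) + 1.
have C_gt0 : 0 < C by rewrite ltr_wpDl // !(addr_ge0, mulr_ge0).
have LM_C : L * M <= C.
  by rewrite /C -addrA lerDl !(addr_ge0, mulr_ge0).
have small (h : R) : `|h| <= e / C -> C * `|h| ^+ 2 <= e * `|h|.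
  by rewrite ler_pdivlMr // expr2 mulrA => hC; rewrite ler_wpM2r // mulrC.
have back : forall t s, 0 <= t -> 0 <= s -> s <= 1 ->
    `|x0 t - x0 (t + s) + s *: g (x0 (t + s))| <= C * s ^+ 2.
  move=> {}t s {}t0 s0 s1.
  have := xT t s t0 s0; set a := x0 (t + s); set b := x0 t => ab.
  have -> : b - a + s *: g a = s *: (g a - g b) - (a - b - s *: g b).
    by rewrite scalerBr (opprB (a - b)) addrA subrK opprB [RHS]addrC.
  apply: (le_trans (ler_normB _ _)); rewrite normrZ (ger0_norm s0).
  have abs : `|a - b| <= (L * M + M) * s.
    have -> : a - b = (a - b - s *: g b) + s *: g b by rewrite subrK.
    apply: (le_trans (ler_normD _ _)); rewrite normrZ (ger0_norm s0) mulrDl.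
    rewrite lerD //; last by rewrite mulrC ler_wpM2r.
    apply: le_trans ab _; rewrite ler_wpM2l ?mulr_ge0 //.
    by rewrite expr2 ler_piMr.
  have gab : `|g a - g b| <= L * ((L * M + M) * s).
    by apply: (le_trans (gL _ _)); exact: ler_wpM2l.
  have : s * `|g a - g b| <= s * (L * ((L * M + M) * s)) by exact: ler_wpM2l.
  have := sqr_ge0 s; rewrite /C; lra.
have eC : 0 < e / C by rewrite divr_gt0.
have [t_gt0|] := ltP 0 t; last first.
  move=> tle0; have {t0 tle0}-> : t = 0 by apply: le_anti; rewrite t0 tle0.
  exists (e / C) => // h /ltW hC; rewrite add0r (xE 0) // x00.
  have [h0|h0] := ltP h 0.
    by rewrite /x h0 addrAC addrK subrr normr0 mulr_ge0 // ltW.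
  rewrite xE //. apply: le_trans _ (small _ hC).
  have := xT 0 h (lexx 0) h0; rewrite add0r x00 (ger0_norm h0).
  by move=> /le_trans; apply; rewrite ler_wpM2r ?sqr_ge0.
exists (Num.min t (Num.min 1 (e / C))); first by rewrite !lt_min t_gt0 ltr01.
move=> h; rewrite !lt_min => /and3P[ht /ltW h1 /ltW hC].
have th0 : 0 <= t + h by move: ht => /ltr_normlP[]; lra.
rewrite !xE //; apply: le_trans _ (small _ hC).
have [h0|h0] := leP 0 h.
  have := xT t h t0 h0; rewrite (ger0_norm h0) => /le_trans; apply.
  by rewrite ler_wpM2r ?sqr_ge0.
have := back (t + h) (- h) th0; rewrite oppr_ge0 (ltW h0) addrK scaleNr.
rewrite (ltr0_norm h0); apply => //.
by rewrite -(ltr0_norm h0).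
Qed.

(** * Lipschitz bounds *)

Lemma closed_norm_le {R : realType} {V : normedModType R} (r : R) :
  closed [set x : V | `|x| <= r].
Proof.
apply: (@closed_comp _ _ (fun x : V => `|x|) [set s | s <= r]).
  by move=> x _; exact: norm_continuous.
exact: closed_le.
Qed.

Lemma compact_norm_le {R : realType} {n : nat} (r : R) :
  compact [set x : 'rV[R]_n | `|x| <= r].
Proof.
apply: bounded_closed_compact; last exact: closed_norm_le.
by exists r; split; [exact: num_real|move=> M /ltW rM x /le_trans; exact].
Qed.

Lemma diff_norm_le {R : realType} {n m : nat} (f : 'rV[R]_n -> 'rV[R]_m)
    (a v : 'rV[R]_n) :
  differentiable f a ->
  `|'d f a v| <= `|v| * \sum_(j < n) `|'D_(delta_mx 0 j) f a|.
Proof.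
move=> df; rewrite [v in 'd f a v]row_sum_delta linear_sum.
apply: (le_trans (ler_norm_sum _ _ _)); rewrite mulr_sumr.
apply: ler_sum => j _; rewrite linearZ normrZ (deriveE _ df).
by rewrite ler_wpM2r // ler_coord_norm.
Qed.

Lemma continuous_sum_norm {R : realType} {V W : normedModType R} {n : nat}
    (F : 'I_n -> V -> W) (x : V) :
  (forall j, {for x, continuous (F j)}) ->
  {for x, continuous (fun y => \sum_(j < n) `|F j y|)}.
Proof.
move=> cF; apply: (@cvg_big R 'I_n +%R 0 predT add_continuous) => j _.
by apply: cvg_norm; exact: cF.
Qed.

(** Segments stay in the convex cube, so the mean value theorem applies to each coordinate; the sum
    of the norms of the partial derivatives attains a maximum on the compact cube. *)
Lemma C1_lipschitz {R : realType} {n m : nat} (G : set 'rV[R]_n)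
    (f : 'rV[R]_n -> 'rV[R]_m) (rho : R) :
  0 <= rho -> (forall x, `|x| <= rho -> G x) -> Ck 1 G f ->
  exists2 L, 0 <= L & forall x y, `|x| <= rho -> `|y| <= rho ->
    `|f x - f y| <= L * `|x - y|.
Proof.
move=> rho0 QG [df cf].
pose Q := [set x : 'rV[R]_n | `|x| <= rho].
have cQ : compact Q := compact_norm_le _.
pose B x := \sum_(j < n) `|'D_(delta_mx 0 j) f x|.
have cB : {within Q, continuous B}.
  apply: continuous_in_subspaceT => x; rewrite inE => /QG Gx.
  by apply: continuous_sum_norm => j; exact: cf.
have Q0 : Q 0 by rewrite /Q /= normr0.
have [|c _ cmax] := EVT_max_rV _ cQ cB; first by exists 0.
exists (B c); first exact: sumr_ge0.
move=> x y xr yr; apply: rV_norm_ler => [|i].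
  by rewrite mulr_ge0 // sumr_ge0.
pose d t := 'd f (y + t *: (x - y)) (x - y).
have Qt t : 0 <= t <= 1 -> Q (y + t *: (x - y)).
  move=> /andP[t0 t1]; rewrite /Q /=.
  have -> : y + t *: (x - y) = (1 - t) *: y + t *: x.
    by rewrite scalerBr scalerBl scale1r addrA addrAC.
  apply: (le_trans (ler_normD _ _)); rewrite !normrZ.
  rewrite ger0_norm ?subr_ge0 // ger0_norm //.
  have -> : rho = (1 - t) * rho + t * rho by ring.
  by rewrite lerD ?ler_wpM2l ?subr_ge0.
have fd (t : R) : 0 <= t <= 1 ->
    is_derive t 1 (fun s => f (y + s *: (x - y)) 0 i) (d t 0 i).
  by move=> /Qt/QG Gt; apply: is_derive_coord; apply: is_derive_line; exact: df.
have [||t t01] := @MVT_segment R (fun s => f (y + s *: (x - y)) 0 i)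
    (fun t => d t 0 i) 0 1 ler01.
- by move=> t /andP[t0 t1]; apply: fd; rewrite !ltW.
- apply: continuous_in_subspaceT => t; rewrite inE /= in_itv /= => /fd.
  exact: is_derive_continuous.
rewrite subr0 mulr1 scale1r scale0r addr0 subrKC !mxE => ->.
rewrite in_itv /= in t01.
apply: (le_trans (ler_coord_norm _ _)); rewrite /d mulrC.
apply: (le_trans (diff_norm_le _ _ _ (df _ (QG _ (Qt _ t01))))).
by rewrite ler_wpM2l // cmax // inE; exact: Qt.
Qed.

(** A retraction onto the sup-norm ball of radius [rho], 1-Lipschitz for that norm; composing with
    it makes a field that is Lipschitz on the ball globally Lipschitz and bounded. *)
Definition clip {R : realType} {n : nat} (rho : R) (y : 'rV[R]_n) : 'rV[R]_n :=
  \row_i Num.max (- rho) (Num.min rho (y 0 i)).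

Lemma clip_norm {R : realType} {n : nat} (rho : R) (y : 'rV[R]_n) :
  0 <= rho -> `|clip rho y| <= rho.
Proof.
move=> r0; apply: rV_norm_ler => // i; rewrite mxE ler_norml.
by rewrite le_max lexx ge_max ge_min lexx /= andbT ge0_cp.
Qed.

Lemma clip_id {R : realType} {n : nat} (rho : R) (y : 'rV[R]_n) :
  `|y| <= rho -> clip rho y = y.
Proof.
move=> yr; apply/rowP => i; rewrite mxE.
have := le_trans (ler_coord_norm y i) yr; rewrite ler_norml => /andP[a b].
by rewrite min_r // max_r.
Qed.

Lemma clip_lipschitz {R : realType} {n : nat} (rho : R) (y z : 'rV[R]_n) :
  `|clip rho y - clip rho z| <= `|y - z|.
Proof.
apply: rV_norm_ler => // i; apply: le_trans (ler_coord_norm _ i).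
rewrite !mxE; move: (y 0 i) (z 0 i) => a b.
have [ab ba] : a - b <= `|a - b| /\ b - a <= `|a - b|.
  by rewrite {2}distrC !ler_norm.
by apply/ler_normlP; case: (leP rho a) => ?; case: (leP rho b) => ?;
  do 2?case: (leP (- rho) _) => ?; split; lra.
Qed.

(** * Lyapunov stability *)

(** From an interior point one can move inside [K] towards [z + w], which shortens the distance
    strictly unless [w = 0]. *)
Lemma interior_proximal_normal {R : realType} {n : nat} (K : set 'rV[R]_n)
    (z w : 'rV[R]_n) :
  nbhs z K -> (forall y, K y -> dot w w <= dot (z + w - y) (z + w - y)) ->
  w = 0.
Proof.
move=> zK Kw; apply: dot_eq0; apply/eqP; rewrite eq_le dot_ge0 andbT.
near (0 : R)^'+ => t.
have t0 : 0 < t by [].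
have t1 : t < 1 by near: t; exact: nbhs_right_lt.
have Kt : K (z + t *: w).
  near: t; apply: cvg_within.
  have := continuous_segment z w (0 : R).
  by apply; rewrite scale0r addr0.
have := Kw _ Kt; rewrite (_ : z + w - _ = (1 - t) *: w); last first.
  by rewrite opprD addrACA subrr add0r scalerBl scale1r.
rewrite dotZl dotZr; have := dot_ge0 w; move: (dot w w) => d d0.
rewrite mulrA => H; rewrite leNgt; apply/negP => dpos.
have : (1 - t) * (1 - t) * d < d by rewrite gtr_pMl //; nra.
by rewrite ltNge H.
Unshelve. all: by end_near. Qed.

Lemma closure_internal_proximal {R : realType} {m : nat}
    (H : set 'rV[R]_m.+1) (N : 'rV[R]_m.+1 -> 'rV[R]_m.+1)
    (z w v : 'rV[R]_m.+1) :
  compact H -> smooth_submanifold m H -> inner_unit_normal H N ->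
  (H z -> 0 <= dot (N z) v) ->
  (H `|` internal_component H) z ->
  (forall y, (H `|` internal_component H) y ->
     dot w w <= dot (z + w - y) (z + w - y)) ->
  dot w v <= 0.
Proof.
move=> cH sm nN Nv [Hz|Iz] Kw.
  exact: (proximal_normal_le0 _ _ _ _ _ sm nN Hz Kw (Nv Hz)).
rewrite (interior_proximal_normal _ _ _ _ Kw); last first.
  apply: filterS (open_nbhs_nbhs (conj (internal_component_open _ cH) Iz)).
  by move=> y; right.
by rewrite -(scale0r v) dotZl mul0r.
Qed.

Lemma converges_to_norm {R : realType} {n : nat} (H : nat -> set 'rV[R]_n)
    (r : R) :
  (forall i, compact (H i)) -> converges_to H 0 -> 0 < r ->
  exists i, forall y, H i y -> `|y| < r.
Proof.
move=> cH /cvgrPdist_lt/(_ r) Hc r0; have [i _ /(_ i (leqnn i))] := Hc r0.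
rewrite sub0r normrN => supr; exists i => y Hy.
apply: (le_lt_trans (norm_le_enorm y)); apply: le_lt_trans supr.
apply: le_trans (ler_norm _); rewrite -edist0.
(* The supremum is an upper bound because compactness of [H i] bounds the set of distances. *)
apply: ub_le_sup; last by exists y.
have [B [_ HB]] := compact_bounded (cH i).
exists (n%:R * (`|B| + 1)) => _ [z Hz <-]; rewrite edist0.
apply: (le_trans (enorm_le_norm z)); rewrite ler_wpM2l //.
by apply: HB => //; rewrite (le_lt_trans (ler_norm B)) // ltrDl.
Qed.

Lemma dot_lipschitz {R : realType} {n : nat} (y z a b : 'rV[R]_n) (L : R) :
  0 <= L -> `|a - b| <= L * `|y - z| ->
  dot (y - z) (a - b) <= n%:R * L * dot (y - z) (y - z).
Proof.
move=> L0 ab; apply: (le_trans (ler_norm _)).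
apply: (le_trans (ler_norm_dot _ _)); rewrite -mulrA ler_wpM2l //.
apply: (@le_trans _ _ (L * `|y - z| ^+ 2)).
  by rewrite expr2 mulrCA ler_wpM2l.
by rewrite ler_wpM2l // sqr_norm_le_dot.
Qed.

Theorem theorem2p1 (R : realType) (n : nat) (G : set 'rV[R]_n)
  (f : 'rV[R]_n -> 'rV[R]_n)
  (H : nat -> set 'rV[R]_n) (N : nat -> 'rV[R]_n -> 'rV[R]_n)
  (n_ge2 : (2 <= n)%N)
  (G_open : open G) (G_0 : G 0)
  (f_C1 : Ck 1 G f) (f_0 : f 0 = 0)
  (H_hypersurface : forall i, connected_closed_hypersurface (H i))
  (H_in_G : forall i, H i `<=` G)
  (H_nested : nested H)
  (H_bounds : forall i, bounds (H i) 0)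
  (H_cvg : converges_to H 0)
  (N_normal : forall i, inner_unit_normal (H i) (N i))
  (S_ge0 : forall i x, H i x -> 0 <= dot (N i x) (f x)) :
  equilibrium G f 0 /\ lyapunov_stable G f 0.
Proof.
split=> // eps eps0.
have [m En] : exists m, n = m.+1 by exists n.-1; rewrite prednK // ltnW.
subst n.
have cH i : compact (H i) by have [] := H_hypersurface i.
have [rho rho0 QG] : exists2 rho : R, 0 < rho & forall x, `|x| <= rho -> G x.
  have /nbhs_ballP[e /= e0 eG] := open_nbhs_nbhs (conj G_open G_0).
  exists (e / 2); first by rewrite divr_gt0.
  move=> x xe; apply: eG; rewrite -ball_normE /= sub0r normrN.
  by rewrite (le_lt_trans xe) // ltr_pdivrMr // mulr_natr mulr2n ltrDl.
have [L L0 fL] := C1_lipschitz _ _ _ (ltW rho0) QG f_C1.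
(* Half of [rho] leaves room around [K] inside the cube; the factor [m.+1] converts the sup norm to
   the Euclidean one. *)
pose r := Num.min (rho / 2) (eps / m.+1%:R).
have r0 : 0 < r by rewrite lt_min !divr_gt0.
have [i Hr] := converges_to_norm H r cH H_cvg r0.
pose K := H i `|` internal_component (H i).
have Kr x : K x -> `|x| < r.
  by move=> [/Hr //|]; exact: internal_component_norm_lt.
have K_eps x : K x -> enorm x < eps.
  move=> /Kr; rewrite lt_min => /andP[_ xe].
  by apply: (le_lt_trans (enorm_le_norm x)); rewrite mulrC -ltr_pdivlMr.
have K_rho x : K x -> `|x| <= rho / 2.
  by move=> /Kr; rewrite lt_min => /andP[/ltW].
have rho2 : rho / 2 <= rho by lra.
have cK : compact K.
  apply: bounded_closed_compact; last exact: closure_internal_closed.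
  exists r; split; first exact: num_real.
  by move=> M rM x /Kr xr /=; rewrite ltW // (lt_trans xr).
(* A general [F] serves twice: [f] itself for arbitrary solutions, and the clipped field for
   existence. *)
have invariant (F : 'rV[R]_m.+1 -> 'rV[R]_m.+1) (x : R -> 'rV[R]_m.+1) :
    (forall y, `|y| <= rho -> F y = f y) -> K (x 0) ->
    (forall t : R, 0 <= t -> is_derive t 1 x (F (x t))) ->
    forall t, 0 <= t -> K (x t).
  move=> Ff Kx x'.
  (* Points within [rho / 2] of [K] still lie in the cube of radius [rho], where [F = f] is
     Lipschitz. *)
  apply: (proximal_invariance K F x (m.+1%:R * L) ((rho / 2) ^+ 2)) => //.
  - by rewrite mulr_ge0.
  - by rewrite exprn_gt0 // divr_gt0.
  - move=> z w Kz Kw; rewrite Ff ?(le_trans (K_rho _ Kz)) //.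
    have [_ _ _ sm] := H_hypersurface i.
    exact: (closure_internal_proximal _ _ _ _ _ (cH i) sm (N_normal i)
      (S_ge0 i z) Kz Kw).
  - move=> z y Kz yz.
    have zr := le_trans (K_rho _ Kz) rho2.
    have yr : `|y| <= rho.
      have yz2 : `|y - z| <= rho / 2.
        rewrite -(@ler_sqr R) ?nnegrE ?divr_ge0 ?(ltW rho0) //.
        exact: le_trans (sqr_norm_le_dot _) yz.
      rewrite -[y](subrK z) (le_trans (ler_normD _ _)) //.
      have := K_rho _ Kz; lra.
    by rewrite !Ff //; apply: dot_lipschitz => //; exact: fL.
have I0 := bounds_internal_component _ (cH i) (H_bounds i).
have /nbhs_ballP[delta /= delta0 deltaI] :=
  open_nbhs_nbhs (conj (internal_component_open _ (cH i)) I0).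
exists delta => // p; rewrite subr0 => p_delta.
have Kp : K p.
  right; apply: deltaI; rewrite -ball_normE /= sub0r normrN.
  exact: le_lt_trans (norm_le_enorm p) p_delta.
split; last first.
  move=> x [x0 xG] t t0; rewrite subr0; apply: K_eps.
  apply: (invariant f x) => //; first by rewrite x0.
  by move=> s /xG[].
(* Since [f 0 = 0], the Lipschitz bound also yields |f| <= L rho on the cube. *)
have [||x [x0 x']] := lipschitz_ode_solution (f \o clip rho) L (L * rho) p
    (fun r => compact_norm_le r) L0.
- move=> y /=; have cy := clip_norm rho y (ltW rho0).
  have := fL _ 0 cy; rewrite normr0 f_0 !subr0 => /(_ (ltW rho0)) /le_trans.
  by apply; rewrite ler_wpM2l.
- move=> y z /=; have cn u := @clip_norm R m.+1 rho u (ltW rho0).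
  apply: le_trans (fL _ _ (cn y) (cn z)) _.
  by rewrite ler_wpM2l // clip_lipschitz.
have Kx : forall t, 0 <= t -> K (x t).
  apply: (invariant (f \o clip rho)) => //; last by rewrite x0.
  by move=> y yr /=; rewrite clip_id.
exists x; split => // t t0; have := le_trans (K_rho _ (Kx _ t0)) rho2 => xr.
split; first exact: QG.
by have := x' _ t0; rewrite /= clip_id.
Qed.
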